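(* Let $G$ be a seed graph which is $r$-regular, and consider the Corona graphs $G^{(t)}=G^{(t-1)}\circ G$ generated by $G$. Then the cumulative degree distribution of the Corona graphs decays exponentially.
   Context: A seed graph is a finite simple connected graph. The corona product $G_1\circ G_2$ of two graphs is obtained by taking one copy of $G_1$ and $|V(G_1)|$ copies of $G_2$, and joining the $i$-th node of $G_1$ to every node of the $i$-th copy of $G_2$, for each $i$. The Corona graphs generated by a seed graph $G$ are defined by $G^{(0)}=G$ and $G^{(m+1)}=G^{(m)}\circ G$ for $m\ge 0$. For a graph, $P(k)$ denotes the fraction of nodes having degree $k$, and the cumulative degree distribution is $P_c(k)=\sum_{k'\ge k}P(k')$, the probability that the degree of a node is greater than or equal to $k$. *)

(* Defs.v *)
From HB Require Import structures.
From mathcomp Require Import all_boot all_order all_algebra.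
From mathcomp Require Import all_classical all_reals all_analysis.

Set Implicit Arguments.
Unset Strict Implicit.
Unset Printing Implicit Defensive.

Import Order.TTheory GRing.Theory Num.Theory.
Local Open Scope ring_scope.

Record sgraph := SGraph {
  vertex :> finType;
  adj : rel vertex;
  adj_sym : symmetric adj;
  adj_irrefl : irreflexive adj
}.

(* The null graph is not regarded as connected. *)
Definition seed_graph (G : sgraph) : Prop :=
  (0 < #|G|)%N /\ forall x y : G, connect (@adj G) x y.

Definition degree (G : sgraph) (v : G) : nat := #|[set w : G | adj v w]|.

Definition regular (G : sgraph) (r : nat) : Prop :=
  forall v : G, degree v = r.

Definition max_degree (G : sgraph) : nat := (\max_(v : G) degree v)%N.

Section Corona.
Variables G1 G2 : sgraph.

(* [inl u] is the node u of G1; [inr (u, a)] is the node a of the copy of G2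
   attached to u. *)
Definition corona_adj (x y : G1 + G1 * G2) : bool :=
  match x, y with
  | inl u, inl v => adj u v
  | inl u, inr (v, _) => u == v
  | inr (u, _), inl v => u == v
  | inr (u, a), inr (v, b) => (u == v) && adj a b
  end.

Lemma corona_adj_sym : symmetric corona_adj.
Proof.
by move=> [u|[u a]] [v|[v b]] /=; rewrite 1?[v == u]eq_sym // adj_sym.
Qed.

Lemma corona_adj_irrefl : irreflexive corona_adj.
Proof. by move=> [u|[u a]] /=; rewrite adj_irrefl ?andbF. Qed.

Definition corona : sgraph := SGraph corona_adj_sym corona_adj_irrefl.

End Corona.

Fixpoint corona_graph (G : sgraph) (m : nat) : sgraph :=
  if m is m'.+1 then corona (corona_graph G m') G else G.

Definition degree_dist (R : realType) (G : sgraph) (k : nat) : R :=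
  #|[set v : G | degree v == k]|%:R / #|G|%:R.

(* Degrees in a simple graph are less than #|G|, so no term of the sum over
   all k' >= k is lost by truncating it there. *)
Definition cumulative_degree_dist (R : realType) (G : sgraph) (k : nat) : R :=
  \sum_(k <= k' < #|G|) degree_dist R G k'.

(* P_c(k) is of order exp (- lambda k) along a sequence of graphs, with
   constants that do not depend on the graph: for one finite graph alone an
   upper bound would say nothing.  P_c(k) = 0 beyond the maximum degree, so
   the lower bound can only be asked for up to that degree. *)
Definition cumulative_degree_decays_exponentially
    (R : realType) (H : nat -> sgraph) : Prop :=
  exists lambda c C : R,
    [/\ 0 < lambda, 0 < c, 0 < C &
        forall t k : nat,
          cumulative_degree_dist R (H t) k <= C * expR (- (lambda * k%:R)) /\
          ((k <= max_degree (H t))%N ->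
           c * expR (- (lambda * k%:R)) <= cumulative_degree_dist R (H t) k)].

(* Main.v *)
(** In [G1 o G2] every node of [G1] gains [n = #|G2|] neighbours, and every new
    node has degree [r + 1] when [G2] is [r]-regular.  Hence the cumulative
    distribution satisfies
    [P_(t+1)(k) = (P_t(k - n) + n * [k <= r + 1]) / (n + 1)]:
    shifting [k] by [n] divides it by [n + 1], so that the decay rate is
    [lambda = ln (n + 1) / n]. *)

Require Import Defs.
From mathcomp Require Import all_boot all_order all_algebra.
From mathcomp Require Import all_classical all_reals all_analysis.

Set Implicit Arguments.
Unset Strict Implicit.
Unset Printing Implicit Defensive.

Import Order.TTheory GRing.Theory Num.Theory.
Local Open Scope ring_scope.

(** The integer numerator of the cumulative distribution, so that the effect of a corona becomes
    pure counting in [nat]. *)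
Definition tail_card (G : sgraph) (k : nat) : nat :=
  #|[set v : G | (k <= degree v)%N]|.

Lemma degreeE (G : sgraph) (v : G) : degree v = (\sum_(w : G) adj v w)%N.
Proof. by rewrite /degree -sum1dep_card big_mkcond. Qed.

Lemma tail_cardE (G : sgraph) (k : nat) :
  tail_card G k = (\sum_(v : G) (k <= degree v))%N.
Proof. by rewrite /tail_card -sum1dep_card big_mkcond. Qed.

Lemma degree_lt_card (G : sgraph) (v : G) : (degree v < #|G|)%N.
Proof.
rewrite /degree -cardsT; apply: proper_card; apply/properP; split.
  by apply/fintype.subsetP => w; rewrite inE.
by exists v; rewrite ?inE // adj_irrefl.
Qed.

Lemma cumulative_degree_distE (R : realType) (G : sgraph) (k : nat) :
  cumulative_degree_dist R G k = (tail_card G k)%:R / #|G|%:R.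
Proof.
rewrite /cumulative_degree_dist /degree_dist -mulr_suml -natr_sum.
congr (_%:R / _); rewrite tail_cardE.
under eq_bigr => i _ do rewrite -sum1dep_card big_mkcond /=.
rewrite exchange_big /=; apply: eq_bigr => v _.
(* After exchanging the sums, [v] contributes only at [k' = degree v]; that index lies below [#|G|],
   so it is hit exactly when [k <= degree v]. *)
have [kv|vk] := leqP k (degree v); last first.
  rewrite big_nat big1 // => i /andP[ki _].
  by rewrite ltn_eqF // (leq_trans vk ki).
rewrite (big_cat_nat kv (ltnW (degree_lt_card v))) /=.
rewrite big_nat big1 ?add0n; last by move=> i /andP[_ iv]; rewrite gtn_eqF.
rewrite big_ltn ?degree_lt_card // eqxx big_nat big1 ?addn0 //.
by move=> i /andP[vi _]; rewrite ltn_eqF.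
Qed.

Lemma tail_card0 (G : sgraph) : tail_card G 0 = #|G|.
Proof. by rewrite tail_cardE sum1_card. Qed.

Lemma tail_card_le (G : sgraph) (k : nat) : (tail_card G k <= #|G|)%N.
Proof. exact: max_card. Qed.

Lemma tail_card_regular (G : sgraph) (r k : nat) :
  regular G r -> tail_card G k = (#|G| * (k <= r))%N.
Proof.
move=> Gr; rewrite tail_cardE; under eq_bigr do rewrite Gr.
by rewrite sum_nat_const.
Qed.

Section Corona.
Variables (G1 G2 : sgraph) (r : nat).
Hypothesis G2r : regular G2 r.

Lemma card_corona : #|corona G1 G2| = (#|G1| * #|G2|.+1)%N.
Proof. by rewrite /= card_sum card_prod mulnS. Qed.

Lemma degree_corona_inl (u : G1) :
  @degree (corona G1 G2) (inl u) = (degree u + #|G2|)%N.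
Proof.
rewrite !degreeE /= big_sumType /=; congr (_ + _)%N.
rewrite (eq_bigr (fun p : G1 * G2 => (u == p.1) : nat)); last by case.
rewrite -(pair_bigA _ (fun v (_ : G2) => nat_of_bool (u == v))) /=.
under eq_bigr do rewrite sum_nat_const.
rewrite (bigD1 u) //= eqxx muln1 big1 ?addn0 //.
by move=> v /negbTE; rewrite eq_sym => ->; rewrite muln0.
Qed.

(** One neighbour is the node [u] to which the copy is attached; the other [r] lie in the same
    copy. *)
Lemma degree_corona_inr (u : G1) (a : G2) :
  @degree (corona G1 G2) (inr (u, a)) = r.+1.
Proof.
rewrite degreeE /= big_sumType /= -add1n -(G2r a) degreeE; congr (_ + _)%N.
  rewrite (bigD1 u) //= eqxx big1 // => v /negbTE.
  by rewrite eq_sym => ->.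
rewrite (eq_bigr (fun p : G1 * G2 => ((u == p.1) && adj a p.2) : nat));
  last by case.
rewrite -(pair_bigA _ (fun v b => nat_of_bool ((u == v) && adj a b))) /=.
rewrite (bigD1 u) //= eqxx [X in (_ + X)%N]big1 ?addn0 //.
by move=> v /negbTE; rewrite eq_sym => ->; rewrite big1.
Qed.

(** Truncated subtraction is right here: for [k <= #|G2|] every old node qualifies, as
    [tail_card G1 0] says. *)
Lemma tail_card_corona (k : nat) :
  tail_card (corona G1 G2) k =
  (tail_card G1 (k - #|G2|) + #|G1| * #|G2| * (k <= r.+1))%N.
Proof.
rewrite !tail_cardE /= big_sumType /=; congr (_ + _)%N.
  by apply: eq_bigr => u _; rewrite degree_corona_inl leq_subLR addnC.
rewrite -card_prod -sum_nat_const.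
by apply: eq_bigr => -[u a] _; rewrite degree_corona_inr.
Qed.

Lemma max_degree_corona : (max_degree (corona G1 G2) <= max_degree G1 + #|G2|)%N.
Proof.
apply/bigmax_leqP => -[u|[u a]] _.
  by rewrite degree_corona_inl leq_add2r (leq_bigmax (F := @degree G1)).
(* New nodes stay within the bound because [r < #|G2|] in a simple graph. *)
by rewrite degree_corona_inr -(G2r a) (leq_trans (degree_lt_card a)) ?leq_addl.
Qed.

End Corona.

Section Decay.
Variables (R : realType) (G : sgraph) (r : nat).
Hypotheses (G_gt0 : (0 < #|G|)%N) (Gr : regular G r).

Let n := #|G|.
Let lambda : R := ln n.+1%:R / n%:R.
Let P t k := cumulative_degree_dist R (corona_graph G t) k.
Let decay (k : nat) : R := expR (- (lambda * k%:R)).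

Lemma card_corona_graph_gt0 t : (0 < #|corona_graph G t|)%N.
Proof. by elim: t => //= t IH; rewrite card_corona muln_gt0 IH. Qed.

Lemma decay_rate_gt0 : 0 < lambda.
Proof. by rewrite divr_gt0 ?ltr0n // ln_gt0 // ltr1n. Qed.

(** This identity dictates the choice of [lambda]: dividing by [n + 1] is the same as decaying over
    a shift by [n]. *)
Lemma decay_card : decay n = n.+1%:R^-1.
Proof.
by rewrite /decay /lambda mulfVK ?expRN ?lnK ?posrE ?ltr0n // pnatr_eq0 -lt0n.
Qed.

Lemma decayD k l : decay (k + l) = decay k * decay l.
Proof. by rewrite /decay natrD mulrDr opprD expRD. Qed.

Lemma decay_le k l : (k <= l)%N -> decay l <= decay k.
Proof. by move=> kl; rewrite ler_expR lerN2 ler_pM2l ?decay_rate_gt0 // ler_nat. Qed.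

Lemma decay_le1 k : decay k <= 1.
Proof. by rewrite (le_trans (decay_le (leq0n k))) // /decay mulr0 oppr0 expR0. Qed.

Lemma cumulative_dist_le1 t k : P t k <= 1.
Proof.
rewrite /P cumulative_degree_distE ler_pdivrMr ?ltr0n ?card_corona_graph_gt0 //.
by rewrite mul1r ler_nat tail_card_le.
Qed.

Lemma cumulative_dist0 t : P t 0 = 1.
Proof.
rewrite /P cumulative_degree_distE tail_card0 divff //.
by rewrite pnatr_eq0 -lt0n card_corona_graph_gt0.
Qed.

Lemma cumulative_dist_seed k : P 0 k = (k <= r)%:R.
Proof.
rewrite /P cumulative_degree_distE (tail_card_regular _ Gr) natrM mulrAC divff ?mul1r //.
by rewrite pnatr_eq0 -lt0n.
Qed.

Lemma cumulative_dist_succ t k :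
  P t.+1 k = decay n * (P t (k - n) + n%:R * (k <= r.+1)%:R).
Proof.
rewrite decay_card /P !cumulative_degree_distE /= card_corona.
rewrite (tail_card_corona _ Gr) natrD !natrM invfM.
have m0 : #|corona_graph G t|%:R != 0 :> R.
  by rewrite pnatr_eq0 -lt0n card_corona_graph_gt0.
rewrite mulrA [LHS]mulrC mulrDl; congr (_ * (_ + _)).
by rewrite mulrC -!mulrA mulKf.
Qed.

(** The constant makes the bound at least 1 for [k <= r.+1], where a probability obeys it trivially.
    Beyond [r.+1] the new nodes drop out and the recurrence is a pure shift. *)
Lemma cumulative_dist_upper t k : P t k <= expR (lambda * r.+1%:R) * decay k.
Proof.
elim: t k => [|t IH] k; have [kr|rk] := leqP k r.+1.
1,3: rewrite (le_trans (cumulative_dist_le1 _ _)) // -expRD -[leLHS]expR0 ler_expR subr_ge0.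
1,2: by rewrite ler_pM2l ?decay_rate_gt0 // ler_nat.
  by rewrite cumulative_dist_seed leqNgt (ltnW rk) mulr_ge0 ?expR_ge0.
rewrite cumulative_dist_succ leqNgt rk mulr0 addr0.
apply: (@le_trans _ _ (decay n * (expR (lambda * r.+1%:R) * decay (k - n)))).
  by rewrite ler_pM2l ?expR_gt0.
(* Only [k <= n + (k - n)] holds, since [k] may be smaller than [n]; monotonicity of [decay]
   suffices. *)
by rewrite mulrCA -decayD ler_pM2l ?expR_gt0 // decay_le // -leq_subLR.
Qed.

(** Discarding the new nodes leaves the pure shift by [n], and the maximum degree grows by at most
    [n], so [k - n] stays in range for the induction. *)
Lemma cumulative_dist_lower t k :
  (k <= max_degree (corona_graph G t))%N -> decay n * decay k <= P t k.
Proof.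
elim: t k => [|t IH] k kmax.
  have kr : (k <= r)%N.
    by rewrite (leq_trans kmax) //; apply/bigmax_leqP => v _; rewrite Gr.
  by rewrite cumulative_dist_seed kr -decayD decay_le1.
have kn : (k - n <= max_degree (corona_graph G t))%N.
  by rewrite leq_subLR addnC (leq_trans kmax) // (max_degree_corona _ Gr).
apply: (@le_trans _ _ (decay n * P t (k - n))); last first.
  by rewrite cumulative_dist_succ ler_pM2l ?expR_gt0 // lerDl mulr_ge0.
rewrite ler_pM2l ?expR_gt0 //.
(* For [k < n] the shift stops at 0, where the distribution equals 1; the factor [decay n] in the
   bound pays for this incomplete shift. *)
have [nk|/ltnW kn'] := leqP n k; last first.
  by move: kn'; rewrite -subn_eq0 => /eqP ->; rewrite cumulative_dist0 decay_le1.
by rewrite -[in decay k](subnKC nk) decayD IH.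
Qed.

End Decay.

Theorem theorem1 (R : realType) (G : sgraph) (r : nat)
    (hseed : seed_graph G) (hreg : regular G r) :
  cumulative_degree_decays_exponentially R (corona_graph G).
Proof.
have [G_gt0 _] := hseed.
pose lambda : R := ln #|G|.+1%:R / #|G|%:R.
(* The lower constant is [decay n], that is [1 / (n + 1)]; both constants depend on the seed alone,
   not on [t]. *)
exists lambda, (expR (- (lambda * #|G|%:R))), (expR (lambda * r.+1%:R)).
split; rewrite ?expR_gt0 ?decay_rate_gt0 // => t k.
by split; [exact: cumulative_dist_upper | exact: cumulative_dist_lower].
Qed.
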